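(* At any optimum $(\lambda, N)$ (with associated number of idle couriers $N_i$) of the platform's profit-maximization problem $$\max_{\lambda, N}\ \lambda\big(c_v(\lambda) - \alpha(t_r+t_p) - \beta(2t_d+t_w)\big) - N\,w(N) - KC,$$ in which $t_p$, $t_r$, $t_w$ are determined by $\lambda$, $N$ and a positive root $N_i$ of the fixed-point equation $$N_i = N - 2\lambda\left(\frac{\phi}{\sqrt{N_i/A}} + t_d\right),$$ the market outcome must satisfy $$N_i \ \ge\ \frac{N - 2\lambda t_d}{3}.$$
   Context: Exogenous positive constants: $\tau$ (fraction of EVs needing charging per unit time), $\lambda_0$ (number of potential private vehicle owners), $N_0$ (number of potential couriers), $A$ (city area), $K$ (number of charging stations), $S$ (chargers per station), $t_c$ (mean charging time), $C$ (per-time wage of the coordinator at each station), $\phi,\theta$ (model parameters), and values of time $\alpha>\beta>0$. The numbers $\lambda$ (arrival rate of valet charging customers) and $N$ (number of couriers) are treated as positive real variables. Demand model: $\lambda = \tau\lambda_0 F_v(c_v)$, where $F_v$ is a decreasing function of the generalized cost $c_v$; $c_v(\lambda)$ denotes the inverse demand function. Supply model: $N = N_0F_c(w)$, where $F_c$ is a strictly increasing function of the average courier wage $w$; $w(N)$ denotes the inverse supply function. The generalized cost is $c_v = p_v + \alpha(t_r+t_p)+\beta(2t_d+t_w)$, where $p_v$ is the service price, so that $p_v = c_v(\lambda)-\alpha(t_r+t_p)-\beta(2t_d+t_w)$. Times: - delivery time $t_d = \theta\sqrt{A/K}$ (exogenous given $K$); - pickup time $t_p = \phi/\sqrt{N_i/A}$,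 where the number of idle couriers $N_i>0$ satisfies $N_i = N - 2\lambda t_p - 2\lambda t_d$, i.e. the fixed-point equation in the claim; - response time $t_r = \dfrac{1}{2\lambda}\cdot\dfrac{\rho_d^{\sqrt{2N+2}}}{1-\rho_d}$ with $\rho_d = 2\lambda(t_p+t_d)/N<1$; - waiting time $t_w = \dfrac{K}{\lambda}\cdot\dfrac{\rho_c^{\sqrt{2S+2}}}{1-\rho_c}$ with $\rho_c = \lambda t_c/(KS)<1$. Feasibility requires $\lambda<\min\{KS/t_c,\ N/(2(t_p+t_d))\}$ and the existence of a positive root $N_i$ of the fixed-point equation, i.e. $(N-2\lambda t_d)^{3/2}-\sqrt{27A}\,\phi\lambda\ge 0$ (with $N-2\lambda t_d>0$). When this inequality is strict, the fixed-point equation has two positive roots $N_i$, corresponding to two different market outcomes (hence two values of the objective) under the same $(\lambda,N)$. The maximization is over all such market outcomes: over $(\lambda,N)$ and over the positive root $N_i$. *)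

(* Defs.v *)
From Stdlib Require Import Reals.
Open Scope R_scope.

(* [inv_demand] and [inv_supply] are total functions; [well_posed] pins them
   down only on the sets of attainable arrival rates and courier numbers. *)
Record market := Market {
  tau : R;            (* fraction of EVs needing charging per unit time *)
  lambda0 : R;        (* number of potential private vehicle owners *)
  N0 : R;             (* number of potential couriers *)
  area : R;           (* A *)
  stations : R;       (* K *)
  chargers : R;       (* S, per station *)
  t_c : R;            (* mean charging time *)
  coord_wage : R;     (* C, per-time wage of the coordinator of a station *)
  phi : R;
  theta : R;
  alpha : R;          (* value of time for response and pickup *)
  beta : R;           (* value of time for delivery and waiting *)
  F_v : R -> R;       (* demand, as a function of the generalized cost *)
  F_c : R -> R;       (* supply, as a function of the average courier wage *)
  inv_demand : R -> R;   (* c_v(lambda) *)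
  inv_supply : R -> R    (* w(N) *)
}.

Definition demand (m : market) (c : R) : R := tau m * lambda0 m * F_v m c.

Definition supply (m : market) (w : R) : R := N0 m * F_c m w.

Definition attainable_demand (m : market) (lambda : R) : Prop :=
  exists c, lambda = demand m c.

Definition attainable_supply (m : market) (N : R) : Prop :=
  exists w, N = supply m w.

(* [decreasing] is the non-strict notion, so the inverse demand is only required
   to select a cost that generates lambda; when [F_v] is strictly decreasing
   this determines it uniquely on the attainable rates. *)
Record well_posed (m : market) : Prop := {
  tau_pos : 0 < tau m;
  lambda0_pos : 0 < lambda0 m;
  N0_pos : 0 < N0 m;
  area_pos : 0 < area m;
  stations_pos : 0 < stations m;
  chargers_pos : 0 < chargers m;
  t_c_pos : 0 < t_c m;
  coord_wage_pos : 0 < coord_wage m;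
  phi_pos : 0 < phi m;
  theta_pos : 0 < theta m;
  beta_pos : 0 < beta m;
  beta_lt_alpha : beta m < alpha m;
  F_v_decreasing : decreasing (F_v m);
  F_c_increasing : strict_increasing (F_c m);
  inv_demandE : forall lambda, attainable_demand m lambda ->
    lambda = demand m (inv_demand m lambda);
  inv_supplyE : forall N, attainable_supply m N ->
    N = supply m (inv_supply m N)
}.

Definition t_d (m : market) : R := theta m * sqrt (area m / stations m).

Definition t_p (m : market) (Ni : R) : R := phi m / sqrt (Ni / area m).

Definition rho_d (m : market) (lambda N Ni : R) : R :=
  2 * lambda * (t_p m Ni + t_d m) / N.

Definition t_r (m : market) (lambda N Ni : R) : R :=
  1 / (2 * lambda) *
  (Rpower (rho_d m lambda N Ni) (sqrt (2 * N + 2)) / (1 - rho_d m lambda N Ni)).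

Definition rho_c (m : market) (lambda : R) : R :=
  lambda * t_c m / (stations m * chargers m).

Definition t_w (m : market) (lambda : R) : R :=
  stations m / lambda *
  (Rpower (rho_c m lambda) (sqrt (2 * chargers m + 2)) / (1 - rho_c m lambda)).

Definition service_price (m : market) (lambda N Ni : R) : R :=
  inv_demand m lambda - alpha m * (t_r m lambda N Ni + t_p m Ni)
  - beta m * (2 * t_d m + t_w m lambda).

Definition profit (m : market) (lambda N Ni : R) : R :=
  lambda * service_price m lambda N Ni - N * inv_supply m N
  - stations m * coord_wage m.

(* A market outcome is a triple (lambda, N, Ni): the fixed-point equation may
   have two positive roots Ni for the same (lambda, N). The bound on lambda
   says that rho_c < 1 and rho_d < 1. *)
Record feasible (m : market) (lambda N Ni : R) : Prop := {
  lambda_pos : 0 < lambda;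
  N_pos : 0 < N;
  lambda_attainable : attainable_demand m lambda;
  N_attainable : attainable_supply m N;
  Ni_pos : 0 < Ni;
  Ni_root : Ni = N - 2 * lambda * (phi m / sqrt (Ni / area m) + t_d m);
  lambda_bound : lambda < Rmin (stations m * chargers m / t_c m)
                               (N / (2 * (t_p m Ni + t_d m)))
}.

Definition optimal (m : market) (lambda N Ni : R) : Prop :=
  feasible m lambda N Ni /\
  forall lambda' N' Ni', feasible m lambda' N' Ni' ->
    profit m lambda' N' Ni' <= profit m lambda N Ni.

(* Main.v *)
Require Import Defs.
From Stdlib Require Import Reals Lra.
Open Scope R_scope.

(** Fix [lambda] and [N], and put [M = N - 2 * lambda * t_d].  The fixed-point
    equation for the number of idle couriers says that
    [(M - Ni) * sqrt Ni = 2 * lambda * phi * sqrt A].  The left-hand side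
    increases in [Ni] up to [M / 3] and decreases afterwards, so a root
    [Ni < M / 3] is accompanied by a second root [Ni' > Ni]
    ([larger_root_exists]).  The triple [(lambda, N, Ni')] is again feasible
    ([larger_root_feasible]): with more idle couriers the pickup time is
    strictly shorter, so couriers are less occupied and the response time is no
    longer ([t_r_le]).  Since the other terms of the profit depend on
    [(lambda, N)] only, the platform can charge a strictly higher price for the
    same demand and courier supply ([profit_lt]), which contradicts optimality. *)

(** In terms of [y = sqrt x], two roots [y0 <> y] of [M * y - y ^ 3 = c] are
    related by [y ^ 2 + y * y0 + y0 ^ 2 = M], a quadratic equation in [y]. *)
Lemma larger_root_exists (M x : R) :
  0 < x -> 3 * x < M ->
  exists x', x < x' /\ (M - x') * sqrt x' = (M - x) * sqrt x.
Proof.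
intros Hx HM.
set (y0 := sqrt x).
assert (Hy0 : 0 < y0) by (apply sqrt_lt_R0; exact Hx).
assert (Hy0x : y0 * y0 = x) by (apply sqrt_sqrt; lra).
set (d := sqrt (4 * M - 3 * x)).
assert (Hd0 : 0 <= d) by apply sqrt_pos.
assert (Hdd : d * d = 4 * M - 3 * x) by (apply sqrt_sqrt; lra).
assert (Hd : 3 * y0 < d) by nra.
set (y := (d - y0) / 2).
assert (Hy : y0 < y) by (unfold y; lra).
assert (HyM : y * y + y * y0 + y0 * y0 = M).
{ replace (y * y + y * y0 + y0 * y0) with ((d * d + 3 * (y0 * y0)) / 4)
    by (unfold y; field).
  lra. }
exists (y * y); split; [nra|].
rewrite sqrt_square by lra.
rewrite <- Hy0x, <- HyM; ring.
Qed.

Lemma fixed_point_iff (M a c x : R) :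
  0 < a -> 0 < x ->
  x = M - c / sqrt (x / a) <-> (M - x) * sqrt x = c * sqrt a.
Proof.
intros Ha Hx.
assert (Hsa : 0 < sqrt a) by (apply sqrt_lt_R0; exact Ha).
assert (Hsx : 0 < sqrt x) by (apply sqrt_lt_R0; exact Hx).
rewrite sqrt_div by lra.
replace (c / (sqrt x / sqrt a)) with (c * sqrt a / sqrt x) by (field; lra).
split; intros H.
- replace (M - x) with (c * sqrt a / sqrt x) by lra.
  field; lra.
- rewrite <- H; field; lra.
Qed.

Section Comparison.

Variables (m : market) (hm : well_posed m).

Lemma t_d_pos : 0 < t_d m.
Proof.
destruct hm.
apply Rmult_lt_0_compat; [assumption|].
apply sqrt_lt_R0, Rdiv_lt_0_compat; assumption.
Qed.

Lemma t_p_pos (Ni : R) : 0 < Ni -> 0 < t_p m Ni.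
Proof.
intros HNi; destruct hm.
apply Rdiv_lt_0_compat; [assumption|].
apply sqrt_lt_R0, Rdiv_lt_0_compat; assumption.
Qed.

Lemma t_p_lt (Ni Ni' : R) : 0 < Ni -> Ni < Ni' -> t_p m Ni' < t_p m Ni.
Proof.
intros HNi Hlt; destruct hm.
assert (Hq : 0 < Ni / area m) by (apply Rdiv_lt_0_compat; assumption).
assert (Hqq : Ni / area m < Ni' / area m)
  by (apply Rmult_lt_compat_r; [apply Rinv_0_lt_compat|]; assumption).
apply Rmult_lt_compat_l; [assumption|].
apply Rinv_lt_contravar.
- apply Rmult_lt_0_compat; apply sqrt_lt_R0; lra.
- apply sqrt_lt_1; lra.
Qed.

Lemma rho_d_pos (lambda N Ni : R) :
  0 < lambda -> 0 < N -> 0 < Ni -> 0 < rho_d m lambda N Ni.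
Proof.
intros Hl HN HNi.
pose proof t_d_pos; pose proof (t_p_pos Ni HNi).
apply Rdiv_lt_0_compat; [apply Rmult_lt_0_compat; lra | assumption].
Qed.

Lemma rho_d_lt_1 (lambda N Ni : R) :
  feasible m lambda N Ni -> rho_d m lambda N Ni < 1.
Proof.
intros [Hl HN _ _ HNi _ Hb].
pose proof t_d_pos; pose proof (t_p_pos Ni HNi).
assert (Hb' : lambda < N / (2 * (t_p m Ni + t_d m)))
  by (eapply Rlt_le_trans; [exact Hb | apply Rmin_r]).
apply Rmult_lt_reg_r with N; [assumption|].
replace (rho_d m lambda N Ni * N) with (lambda * (2 * (t_p m Ni + t_d m)))
  by (unfold rho_d; field; lra).
replace (1 * N)
  with (N / (2 * (t_p m Ni + t_d m)) * (2 * (t_p m Ni + t_d m)))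
  by (field; lra).
apply Rmult_lt_compat_r; lra.
Qed.

Lemma rho_d_le (lambda N Ni Ni' : R) :
  0 < lambda -> 0 < N -> 0 < Ni -> Ni < Ni' ->
  rho_d m lambda N Ni' <= rho_d m lambda N Ni.
Proof.
intros Hl HN HNi Hlt.
pose proof (t_p_lt Ni Ni' HNi Hlt).
apply Rmult_le_compat_r; [left; apply Rinv_0_lt_compat; assumption|].
apply Rmult_le_compat_l; lra.
Qed.

(** The response time is an increasing function of the occupation rate
    [rho_d] of the couriers, which decreases with the number of idle ones. *)
Lemma t_r_le (lambda N Ni Ni' : R) :
  feasible m lambda N Ni -> Ni < Ni' ->
  t_r m lambda N Ni' <= t_r m lambda N Ni.
Proof.
intros Hf Hlt.
pose proof (rho_d_lt_1 _ _ _ Hf) as H1.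
destruct Hf as [Hl HN _ _ HNi _ _].
pose proof (rho_d_le lambda N Ni Ni' Hl HN HNi Hlt) as Hle.
assert (Hp : 0 < rho_d m lambda N Ni') by (apply rho_d_pos; lra).
apply Rmult_le_compat_l.
- left; apply Rdiv_lt_0_compat; lra.
- apply Rmult_le_compat.
  + left; apply exp_pos.
  + left; apply Rinv_0_lt_compat; lra.
  + apply Rle_Rpower_l; [apply sqrt_pos | lra].
  + apply Rinv_le_contravar; lra.
Qed.

Lemma larger_root_feasible (lambda N Ni Ni' : R) :
  feasible m lambda N Ni -> Ni < Ni' ->
  Ni' = N - 2 * lambda * (phi m / sqrt (Ni' / area m) + t_d m) ->
  feasible m lambda N Ni'.
Proof.
intros [Hl HN Hal HaN HNi _ Hb] Hlt Hroot.
pose proof t_d_pos; pose proof (t_p_lt Ni Ni' HNi Hlt).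
assert (HNi' : 0 < Ni') by lra.
pose proof (t_p_pos Ni' HNi').
constructor; try assumption.
eapply Rlt_le_trans; [exact Hb|].
apply Rle_min_compat_l.
apply Rmult_le_compat_l; [lra|].
apply Rinv_le_contravar; lra.
Qed.

Lemma profit_lt (lambda N Ni Ni' : R) :
  feasible m lambda N Ni -> Ni < Ni' ->
  profit m lambda N Ni < profit m lambda N Ni'.
Proof.
intros Hf Hlt.
pose proof (t_r_le _ _ _ _ Hf Hlt) as Hr.
destruct Hf as [Hl _ _ _ HNi _ _].
pose proof (t_p_lt Ni Ni' HNi Hlt) as Hp.
pose proof (beta_pos m hm); pose proof (beta_lt_alpha m hm).
assert (Hprice : service_price m lambda N Ni < service_price m lambda N Ni').
{ assert (alpha m * (t_r m lambda N Ni' + t_p m Ni')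
          < alpha m * (t_r m lambda N Ni + t_p m Ni))
    by (apply Rmult_lt_compat_l; lra).
  unfold service_price; lra. }
apply Rmult_lt_compat_l with (r := lambda) in Hprice; [|assumption].
unfold profit; lra.
Qed.

End Comparison.

Theorem proposition1 (m : market) (hm : well_posed m)
  (lambda N Ni : R) (hopt : optimal m lambda N Ni) :
  Ni >= (N - 2 * lambda * t_d m) / 3.
Proof.
destruct hopt as [Hf Hmax].
apply Rnot_lt_ge; intros Hsmall.
pose proof (area_pos m hm) as HA.
pose proof (Ni_pos _ _ _ _ Hf) as HNi.
pose proof (Ni_root _ _ _ _ Hf) as Hroot.
destruct (larger_root_exists (N - 2 * lambda * t_d m) Ni)
  as [Ni' [Hlt Heq]]; [assumption | lra |].
assert (HNi' : 0 < Ni') by lra.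
assert (Hroot' :
  Ni' = N - 2 * lambda * t_d m - 2 * lambda * phi m / sqrt (Ni' / area m)).
{ apply fixed_point_iff; try assumption.
  rewrite Heq.
  apply fixed_point_iff; try assumption.
  unfold Rdiv in *; lra. }
assert (Hf' : feasible m lambda N Ni').
{ apply (larger_root_feasible m hm lambda N Ni Ni' Hf Hlt).
  unfold Rdiv in *; lra. }
pose proof (Hmax _ _ _ Hf').
pose proof (profit_lt m hm lambda N Ni Ni' Hf Hlt).
lra.
Qed.
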